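(* Let $\mathcal X_1,\mathcal X_2,\mathcal W_1,\mathcal W_2$ be finite nonempty sets, let $g_1:\mathcal W_1\times\mathcal X_1\to[0,1]$ and $g_2:\mathcal W_2\times\mathcal X_2\to[0,1]$ be gain functions, and let $g:(\mathcal W_1\times\mathcal W_2)\times(\mathcal X_1\times\mathcal X_2)\to[0,1]$ be a joint gain function for $g_1,g_2$. For any jointly supported prior $\pi$ on $\mathcal X_1\times\mathcal X_2$ with marginals $\pi_1,\pi_2$ and with $V_g(\pi)>0$, $$H_g(\pi)\ \le\ H_{g_1}(\pi_1)+H_{g_2}(\pi_2)+\log M^{\max}_{g,\pi}.$$
   Context: A prior on a finite set $\mathcal X$ is a probability distribution on $\mathcal X$. For a gain function $g:\mathcal W\times\mathcal X\to[0,1]$: $V_g(\pi)=\max_{w\in\mathcal W}\sum_{x}\pi[x]g(w,x)$ and $H_g(\pi)=-\log V_g(\pi)$. Logarithms are to base 2. A joint gain function $g$ for $g_1,g_2$ is required to satisfy: $g((w_1,w_2),(x_1,x_2))=0$ if and only if $g_1(w_1,x_1)g_2(w_2,x_2)=0$ (no other relation is assumed). The marginals of $\pi$ are $\pi_1[x_1]=\sum_{x_2}\pi[x_1,x_2]$ and $\pi_2[x_2]=\sum_{x_1}\pi[x_1,x_2]$. $\pi$ is jointly supported if for all $x_1,x_2$, $\pi_1[x_1]\pi_2[x_2]\ne 0$ implies $\pi[x_1,x_2]\neq 0$. For $w_1\in\mathcal W_1,w_2\in\mathcal W_2$ let $\mathcal S_{w_1,w_2}=\{(x_1,x_2):\pi[x_1,x_2]\,g((w_1,w_2),(x_1,x_2))\ne0\}$.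 $M^{\max}_{g,\pi}$ is the maximum, over all $(w_1,w_2)\in\mathcal W_1\times\mathcal W_2$ and all $(x_1,x_2)\in\mathcal S_{w_1,w_2}$, of $$\frac{\pi_1[x_1]g_1(w_1,x_1)\cdot\pi_2[x_2]g_2(w_2,x_2)}{\pi[x_1,x_2]\cdot g((w_1,w_2),(x_1,x_2))}.$$ Pairs $(w_1,w_2)$ with $\mathcal S_{w_1,w_2}=\emptyset$ are ignored; $V_g(\pi)>0$ guarantees that some $\mathcal S_{w_1,w_2}$ is nonempty. *)

(* Defs.v *)
From HB Require Import structures.
From mathcomp Require Import all_boot all_order all_algebra.
From mathcomp Require Import reals exp.

Set Implicit Arguments.
Unset Strict Implicit.
Unset Printing Implicit Defensive.

Import Order.TTheory GRing.Theory Num.Theory.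
Local Open Scope ring_scope.

Definition log2 (R : realType) (x : R) : R := ln x / ln 2.

Definition is_prior (R : realType) (X : finType) (pi : X -> R) : Prop :=
  (forall x, 0 <= pi x) /\ \sum_x pi x = 1.

Definition is_gain (R : realType) (W X : finType) (g : W -> X -> R) : Prop :=
  forall w x, 0 <= g w x <= 1.

(* The default value 0 is harmless: for a gain function and a prior all the
   terms are nonnegative, so for nonempty W this is the plain maximum. *)
Definition vulnerability (R : realType) (W X : finType)
    (g : W -> X -> R) (pi : X -> R) : R :=
  \big[Num.max/0]_(w : W) \sum_x pi x * g w x.

(* Meaningful when vulnerability g pi > 0; ln is 0 on nonpositive reals. *)
Definition gentropy (R : realType) (W X : finType)
    (g : W -> X -> R) (pi : X -> R) : R :=
  - log2 (vulnerability g pi).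

Definition is_joint_gain (R : realType) (W1 W2 X1 X2 : finType)
    (g1 : W1 -> X1 -> R) (g2 : W2 -> X2 -> R)
    (g : W1 * W2 -> X1 * X2 -> R) : Prop :=
  is_gain g /\
  forall w1 w2 x1 x2, g (w1, w2) (x1, x2) = 0 <-> g1 w1 x1 * g2 w2 x2 = 0.

Definition marginal1 (R : realType) (X1 X2 : finType)
    (pi : X1 * X2 -> R) (x1 : X1) : R := \sum_x2 pi (x1, x2).

Definition marginal2 (R : realType) (X1 X2 : finType)
    (pi : X1 * X2 -> R) (x2 : X2) : R := \sum_x1 pi (x1, x2).

Definition jointly_supported (R : realType) (X1 X2 : finType)
    (pi : X1 * X2 -> R) : Prop :=
  forall x1 x2, marginal1 pi x1 * marginal2 pi x2 != 0 -> pi (x1, x2) != 0.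

Definition joint_support (R : realType) (W1 W2 X1 X2 : finType)
    (g : W1 * W2 -> X1 * X2 -> R) (pi : X1 * X2 -> R) (w : W1 * W2) :
    {set X1 * X2} :=
  [set x | pi x * g w x != 0].

(* The maximum ranges over all pairs (w, x) with x \in joint_support g pi w.
   All the ratios are nonnegative for gain functions and priors, so the default
   value 0 does not affect the maximum of a nonempty range. *)
Definition Mmax (R : realType) (W1 W2 X1 X2 : finType)
    (g1 : W1 -> X1 -> R) (g2 : W2 -> X2 -> R)
    (g : W1 * W2 -> X1 * X2 -> R) (pi : X1 * X2 -> R) : R :=
  \big[Num.max/0]_(p : (W1 * W2) * (X1 * X2) | p.2 \in joint_support g pi p.1)
    let: ((w1, w2), (x1, x2)) := p in
    (marginal1 pi x1 * g1 w1 x1 * (marginal2 pi x2 * g2 w2 x2)) /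
    (pi (x1, x2) * g (w1, w2) (x1, x2)).

(* Main.v *)
(* Off the support of pi * g both sides of
   pi1 x1 g1(w1,x1) pi2 x2 g2(w2,x2) <= Mmax * pi(x1,x2) g((w1,w2),(x1,x2))
   vanish, by joint support and the joint gain condition; on the support it is
   the definition of Mmax.  Summing over (x1, x2) at maximizing actions w1, w2
   gives V_g1(pi1) V_g2(pi2) <= Mmax V_g(pi), and it remains to take logarithms
   of these positive numbers. *)
Require Import Defs.
From mathcomp Require Import all_boot all_order all_algebra.
From mathcomp Require Import reals exp.
Import Order.TTheory GRing.Theory Num.Theory.
Local Open Scope ring_scope.


Section Vulnerability.
Context {R : realType} {W X : finType} {g : W -> X -> R} { pi : X -> R}.

Lemma le_vulnerability w : \sum_x pi x * g w x <= vulnerability g pi.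
Proof. exact: (le_bigmax_cond _ (fun w => \sum_x pi x * g w x)). Qed.

(** [Num.max] always returns one of its arguments, so the only value that might come from no action
    is the default [0], which positivity excludes. *)
Lemma vulnerability_attained :
  0 < vulnerability g pi ->
  exists w, vulnerability g pi = \sum_x pi x * g w x.
Proof.
rewrite /vulnerability.
elim/big_ind: _ => [|a b IHa IHb|w _ _]; first by rewrite ltxx.
- by case: (leP a b) => _.
- by exists w.
Qed.

Lemma vulnerability_gt0 w x :
  is_gain g -> (forall x, 0 <= pi x) -> 0 < pi x * g w x ->
  0 < vulnerability g pi.
Proof.
move=> g_gain pi_ge0 wx_gt0; apply: lt_le_trans (le_vulnerability w).
rewrite (bigD1 x) //= ltr_wpDr // sumr_ge0 // => y _.
by rewrite mulr_ge0 //; case/andP: (g_gain w y).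
Qed.

End Vulnerability.

Section JointGain.
Context {R : realType} {X1 X2 W1 W2 : finType}.
Context {g1 : W1 -> X1 -> R} {g2 : W2 -> X2 -> R}.
Context {g : W1 * W2 -> X1 * X2 -> R} { pi : X1 * X2 -> R}.
Context (g1_gain : is_gain g1) (g2_gain : is_gain g2).
Context (g_joint : is_joint_gain g1 g2 g) (pi_ge0 : forall x, 0 <= pi x).

Lemma marginal1_ge0 x1 : 0 <= marginal1 pi x1.
Proof. by rewrite sumr_ge0. Qed.

Lemma marginal2_ge0 x2 : 0 <= marginal2 pi x2.
Proof. by rewrite sumr_ge0. Qed.

Lemma marginal1_gt0 x1 x2 : pi (x1, x2) != 0 -> 0 < marginal1 pi x1.
Proof.
move=> pix; apply: (@lt_le_trans _ _ (pi (x1, x2))); first by rewrite lt0r pix /=.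
by rewrite /marginal1 (bigD1 x2) //= lerDl sumr_ge0.
Qed.

Lemma marginal2_gt0 x1 x2 : pi (x1, x2) != 0 -> 0 < marginal2 pi x2.
Proof.
move=> pix; apply: (@lt_le_trans _ _ (pi (x1, x2))); first by rewrite lt0r pix /=.
by rewrite /marginal2 (bigD1 x1) //= lerDl sumr_ge0.
Qed.

(** This makes the logarithms of both marginal entropies genuine. An action pair attaining the joint
    vulnerability has a point with nonzero weight and gain. There both marginals are positive, as
    they dominate [pi (x1, x2)], and both gains are nonzero by the joint gain condition. *)
Lemma marginal_vulnerabilities_gt0 :
  0 < vulnerability g pi ->
  0 < vulnerability g1 (marginal1 pi) /\ 0 < vulnerability g2 (marginal2 pi).
Proof.
move=> V_gt0; have [[w1 w2] Vw] := vulnerability_attained V_gt0.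
have [[x1 x2] /= xN0] : exists x, pi x * g (w1, w2) x != 0.
  apply/existsP; apply: contraTT V_gt0; rewrite negb_exists => /forallP x0.
  by rewrite Vw big1 ?ltxx // => x _; apply/eqP/negbNE/x0.
move: xN0; rewrite mulf_eq0 => /norP[pix gx].
have : g1 w1 x1 * g2 w2 x2 != 0.
  by apply: contra_neq gx => g12; apply/(proj2 g_joint).
rewrite mulf_eq0 => /norP[g1x g2x]; split.
- apply: (vulnerability_gt0 w1 x1) => //; first exact: marginal1_ge0.
  rewrite mulr_gt0 ?(marginal1_gt0 _ _ pix) // lt0r g1x /=.
  by case/andP: (g1_gain w1 x1).
- apply: (vulnerability_gt0 w2 x2) => //; first exact: marginal2_ge0.
  rewrite mulr_gt0 ?(marginal2_gt0 _ _ pix) // lt0r g2x /=.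
  by case/andP: (g2_gain w2 x2).
Qed.

Lemma le_Mmax_mul w1 w2 x1 x2 : jointly_supported pi ->
  (marginal1 pi x1 * g1 w1 x1) * (marginal2 pi x2 * g2 w2 x2) <=
  Mmax g1 g2 g pi * (pi (x1, x2) * g (w1, w2) (x1, x2)).
Proof.
move=> pi_supp; have [x0|xN0] := eqVneq (pi (x1, x2) * g (w1, w2) (x1, x2)) 0.
  (* Grouping marginals apart from gains matches the two ways to vanish: a zero of [pi] kills the
     first group by joint support, a zero of [g] the second. *)
  rewrite x0 mulr0 mulrACA.
  move/eqP: x0; rewrite mulf_eq0 => /orP[pix0|/eqP/(proj2 g_joint)->].
  - rewrite (_ : marginal1 pi x1 * _ = 0) ?mul0r //.
    by apply/eqP; apply: contraTT pix0 => /pi_supp.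
  - by rewrite mulr0.
have x_gt0 : 0 < pi (x1, x2) * g (w1, w2) (x1, x2).
  rewrite lt0r xN0 /= mulr_ge0 //.
  by case/andP: (proj1 g_joint (w1, w2) (x1, x2)).
(* After division, the left side is one of the ratios over which the maximum is taken. *)
rewrite -ler_pdivrMr // /Mmax.
by rewrite (bigD1 ((w1, w2), (x1, x2))) ?inE //= le_max lexx.
Qed.

Lemma Mmax_ge0 : 0 <= Mmax g1 g2 g pi.
Proof. exact: bigmax_ge_id. Qed.

Lemma vulnerability_mul_le : jointly_supported pi ->
  0 < vulnerability g1 (marginal1 pi) -> 0 < vulnerability g2 (marginal2 pi) ->
  vulnerability g1 (marginal1 pi) * vulnerability g2 (marginal2 pi) <=
  Mmax g1 g2 g pi * vulnerability g pi.
Proof.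
move=> pi_supp /vulnerability_attained[w1 ->] /vulnerability_attained[w2 ->].
(* The separately optimal [w1] and [w2] form one candidate action for [g], not necessarily an
   optimal one. *)
apply: le_trans (ler_wpM2l Mmax_ge0 (le_vulnerability (w1, w2))).
rewrite big_distrlr pair_bigA mulr_sumr ler_sum // => -[x1 x2] _.
exact: le_Mmax_mul.
Qed.

End JointGain.

Lemma log2M (R : realType) (x y : R) :
  0 < x -> 0 < y -> log2 (x * y) = log2 x + log2 y.
Proof. by move=> x0 y0; rewrite /log2 lnM ?posrE // mulrDl. Qed.

Lemma ler_log2 (R : realType) (x y : R) :
  0 < x -> x <= y -> log2 x <= log2 y.
Proof.
move=> x0 xy; rewrite /log2 ler_wpM2r ?invr_ge0 ?ln_ge0 ?ler1n //.
by rewrite ler_ln ?posrE // (lt_le_trans x0).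
Qed.

Theorem proposition3p6 (R : realType) (X1 X2 W1 W2 : finType)
    (X1_neq0 : (0 < #|X1|)%N) (X2_neq0 : (0 < #|X2|)%N)
    (W1_neq0 : (0 < #|W1|)%N) (W2_neq0 : (0 < #|W2|)%N)
    (g1 : W1 -> X1 -> R) (g2 : W2 -> X2 -> R)
    (g : W1 * W2 -> X1 * X2 -> R)
    (g1_gain : is_gain g1) (g2_gain : is_gain g2)
    (g_joint : is_joint_gain g1 g2 g)
    (pi : X1 * X2 -> R)
    (pi_prior : is_prior pi) (pi_supp : jointly_supported pi)
    (Vg_gt0 : 0 < vulnerability g pi) :
  gentropy g pi <=
    gentropy g1 (marginal1 pi) + gentropy g2 (marginal2 pi)
    + log2 (Mmax g1 g2 g pi).
Proof.
have [pi_ge0 _] := pi_prior.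
have [V1_gt0 V2_gt0] :=
  marginal_vulnerabilities_gt0 g1_gain g2_gain g_joint pi_ge0 Vg_gt0.
have le_V12 := vulnerability_mul_le g_joint pi_ge0 pi_supp V1_gt0 V2_gt0.
have V12_gt0 := mulr_gt0 V1_gt0 V2_gt0.
(* Splitting the logarithm of [Mmax * V_g] requires both factors positive; the first is, since the
   product and [V_g] are. *)
have M_gt0 : 0 < Mmax g1 g2 g pi.
  by have := lt_le_trans V12_gt0 le_V12; rewrite pmulr_lgt0.
have := ler_log2 _ _ _ V12_gt0 le_V12; rewrite !log2M // => le_log.
by rewrite /gentropy -opprD addrC lerNl opprB lerBlDr [leRHS]addrC.
Qed.
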